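(* The system $\mathsf{DG}$ proves: for every $Y^2$ satisfying standard extensionality, i.e. $(\forall^{\mathrm{st}}f^1,g^1)\big[(\forall^{\mathrm{st}}n^0)(f(n)=g(n))\rightarrow Y(f)=_0Y(g)\big]$, $Y$ is nonstandard (uniformly) continuous on the Cantor space, i.e. $(\forall f,g\le_1 1)\big(f\approx_1 g\rightarrow Y(f)=Y(g)\big)$.
   Context: Finite types: $0$ is a type and if $\rho,\sigma$ are types so is $\rho\to\sigma$; type $1=0\to0$, $2=1\to0$. $\mathsf{E\text{-}HA}^{\omega}$ is Heyting arithmetic in all finite types (intuitionistic logic, Gödel's $T$ constants) with extensionality. Equality $=_0$ is primitive; for $\tau=\tau_1\to\dots\to\tau_k\to0$, $x=_\tau y$ abbreviates $(\forall z_1\dots z_k)(xz_1\dots z_k=_0yz_1\dots z_k)$, and $\le_\tau$ likewise. Extensionality $(\mathsf E_{\rho\to\tau})$: $(\forall\varphi)(\forall x,y)(x=_\rho y\to\varphi(x)=_\tau\varphi(y))$, for all types. Binary sequences (elements of the Cantor space): $f\le_1 1$. Strong majorizability (Howard–Bezem): $x\le^*_0 y$ iff $x\le_0 y$; $x\le^*_{\rho\to\sigma}y$ iff for all $u,v$ with $u\le^*_\rho v$: $xu\le^*_\sigma yv$ and $yu\le^*_\sigma yv$. Monotone: $x\le^*x$; $\tilde\forall,\tilde\exists$ range over monotone objects. The language of $\mathsf{DG}$ adds predicates $\mathrm{st}^\sigma$ (''is standard''); $\forall^{\mathrm{st}},\exists^{\mathrm{st}}$ are the relativised quantifiers, $\tilde\forall^{\mathrm{st}},\tilde\exists^{\mathrm{st}}$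 combine both restrictions. Internal = not containing $\mathrm{st}$. For $f,g$ of type 1, $f\approx_1 g$ means $(\forall^{\mathrm{st}}n^0)(f(n)=g(n))$. $\mathsf{DG}$ is $\mathsf{E\text{-}HA}^\omega$ in the extended language plus: (a) $x=_\sigma y\to(\mathrm{st}(x)\to\mathrm{st}(y))$; (b) $\mathrm{st}(y)\to(x\le^*_\sigma y\to\mathrm{st}(x))$; (c) $\mathrm{st}(t)$ for closed terms $t$; (d) $\mathrm{st}(z)\to(\mathrm{st}(x)\to\mathrm{st}(zx))$; external induction $\Phi(0)\wedge(\forall^{\mathrm{st}}n)(\Phi(n)\to\Phi(n+1))\to(\forall^{\mathrm{st}}n)\Phi(n)$ for any $\Phi$; and for arbitrary $\Phi,\Psi$ and internal $\phi,\psi$: $\mathsf{mAC}^\omega$: $(\tilde\forall^{\mathrm{st}}x)(\tilde\exists^{\mathrm{st}}y)\Phi(x,y)\to(\tilde\exists^{\mathrm{st}}f)(\tilde\forall^{\mathrm{st}}x)(\exists y\le^*f(x))\Phi(x,y)$; $\mathsf R^\omega$: $(\forall x)(\exists^{\mathrm{st}}y)\Phi(x,y)\to(\tilde\exists^{\mathrm{st}}z)(\forall x)(\exists y\le^*z)\Phi(x,y)$; $\mathsf I^\omega$: $(\tilde\forall^{\mathrm{st}}z)(\exists x)(\forall y\le^*z)\phi(x,y)\to(\exists x)(\forall^{\mathrm{st}}y)\phi(x,y)$; $\mathsf{IP}^\omega_{\tilde\forall^{\mathrm{st}}}$: $[(\tilde\forall^{\mathrm{st}}x)\phi(x)\to(\tilde\exists^{\mathrm{st}}y)\Psi(y)]\to(\tilde\exists^{\mathrm{st}}z)[(\tilde\forall^{\mathrm{st}}x)\phi(x)\to(\tilde\exists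 y\le^*z)\Psi(y)]$; $\mathsf M^\omega$: $[(\tilde\forall^{\mathrm{st}}x)\phi(x)\to\psi]\to(\tilde\exists^{\mathrm{st}}y)[(\forall x\le^*y)\phi(x)\to\psi]$; $\mathsf{MAJ}^\omega$: $(\forall^{\mathrm{st}}x)(\exists^{\mathrm{st}}y)(x\le^*y)$. *)

(* Defs.v *)
From Stdlib Require Import List.
Import ListNotations.

Set Implicit Arguments.
Unset Strict Implicit.
Unset Printing Implicit Defensive.

Declare Scope fty_scope.
Declare Scope tm_scope.
Declare Scope fm_scope.
Delimit Scope fty_scope with fty.
Delimit Scope tm_scope with tm.
Delimit Scope fm_scope with fm.

(** * Finite types *)

Inductive fty : Type :=
| ty0 : fty
| arr : fty -> fty -> fty.

Bind Scope fty_scope with fty.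
Notation "rho ~> sigma" := (arr rho sigma)
  (at level 55, right associativity) : fty_scope.

Definition ty1 : fty := (ty0 ~> ty0)%fty.
Definition ty2 : fty := (ty1 ~> ty0)%fty.

(** * Terms: intrinsically typed, with de Bruijn variables

    A context lists the types of the free variables, the most recently bound
    one first. *)

Definition ctx : Type := list fty.

Inductive var : ctx -> fty -> Type :=
| VZ : forall (G : ctx) (s : fty), var (s :: G) s
| VS : forall (G : ctx) (s r : fty), var G s -> var (r :: G) s.
Arguments VZ {G s}.
Arguments VS {G s r} _.

Inductive tm (G : ctx) : fty -> Type :=
| Var : forall s, var G s -> tm G s
| Zero : tm G ty0
| Succ : tm G (ty0 ~> ty0)
| Pi : forall r s, tm G (r ~> s ~> r)
| Sigma : forall r s t, tm G ((r ~> s ~> t) ~> (r ~> s) ~> r ~> t)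
| Rec : forall r, tm G (r ~> (r ~> ty0 ~> r) ~> ty0 ~> r)
| App : forall r s, tm G (r ~> s) -> tm G r -> tm G s.
Arguments Var {G s} _.
Arguments Zero {G}.
Arguments Succ {G}.
Arguments Pi {G r s}.
Arguments Sigma {G r s t}.
Arguments Rec {G r}.
Arguments App {G r s} _ _.

Bind Scope tm_scope with tm.
Notation "a @ b" := (App a b) (at level 40, left associativity) : tm_scope.

Definition v0 {G : ctx} {a : fty} : tm (a :: G) a := Var VZ.
Definition v1 {G : ctx} {a b : fty} : tm (b :: a :: G) a := Var (VS VZ).

Definition renaming (G D : ctx) : Type := forall s, var G s -> var D s.
Definition substitution (G D : ctx) : Type := forall s, var G s -> tm D s.

Definition var_case (P : fty -> Type) (G : ctx) (r : fty)
    (hd : P r) (tl : forall s, var G s -> P s) (s : fty) (v : var (r :: G) s) :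
    P s :=
  match v in var G' s'
    return match G' with
           | [] => unit
           | r' :: G'' => P r' -> (forall s, var G'' s -> P s) -> P s'
           end
  with
  | VZ => fun h _ => h
  | VS w => fun _ t => t _ w
  end hd tl.

Definition shift {G : ctx} {r : fty} : renaming G (r :: G) := fun _ v => VS v.

Definition lift {G D : ctx} {r : fty} (f : renaming G D) :
    renaming (r :: G) (r :: D) :=
  var_case (P := var (r :: D)) VZ (fun _ v => VS (f _ v)).

Fixpoint tren (G D : ctx) (f : renaming G D) (s : fty) (t : tm G s) : tm D s :=
  match t with
  | Var v => Var (f _ v)
  | Zero => Zero
  | Succ => Succ
  | Pi => Pi
  | Sigma => Sigma
  | Rec => Rec
  | App a b => App (tren f a) (tren f b)
  end.

Definition twk {G : ctx} {r s : fty} (t : tm G s) : tm (r :: G) s :=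
  tren shift t.

Definition empty_ren {G : ctx} : renaming [] G :=
  fun s v =>
    match v in var G' s'
      return match G' with [] => var G s' | _ :: _ => unit end
    with
    | VZ => tt
    | VS _ => tt
    end.

Definition tclosed {G : ctx} {s : fty} (t : tm [] s) : tm G s :=
  tren empty_ren t.

Fixpoint tsubst (G D : ctx) (f : substitution G D) (s : fty) (t : tm G s) :
    tm D s :=
  match t with
  | Var v => f _ v
  | Zero => Zero
  | Succ => Succ
  | Pi => Pi
  | Sigma => Sigma
  | Rec => Rec
  | App a b => App (tsubst f a) (tsubst f b)
  end.

Definition up {G D : ctx} {r : fty} (f : substitution G D) :
    substitution (r :: G) (r :: D) :=
  var_case (P := tm (r :: D)) v0 (fun _ v => twk (f _ v)).

Definition single {G : ctx} {r : fty} (t : tm G r) : substitution (r :: G) G :=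
  var_case (P := tm G) t (fun _ v => Var v).

Definition succ_sub {G : ctx} : substitution (ty0 :: G) (ty0 :: G) :=
  var_case (P := tm (ty0 :: G)) (Succ @ v0)%tm (fun _ v => Var (VS v)).

(** * Formulas of the language with the standardness predicates *)

Inductive fm : ctx -> Type :=
| Bot : forall G, fm G
| Eq0 : forall G, tm G ty0 -> tm G ty0 -> fm G
| St : forall G s, tm G s -> fm G
| And : forall G, fm G -> fm G -> fm G
| Or : forall G, fm G -> fm G -> fm G
| Imp : forall G, fm G -> fm G -> fm G
| All : forall G s, fm (s :: G) -> fm G
| Ex : forall G s, fm (s :: G) -> fm G.
Arguments Bot {G}.
Arguments Eq0 {G} _ _.
Arguments St {G s} _.
Arguments And {G} _ _.
Arguments Or {G} _ _.
Arguments Imp {G} _ _.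
Arguments All {G} s _.
Arguments Ex {G} s _.

Bind Scope fm_scope with fm.
Notation "a =0 b" := (Eq0 a%tm b%tm) (at level 70, no associativity) : fm_scope.
Notation "A //\ B" := (And A B) (at level 75, right associativity) : fm_scope.
Notation "A ==> B" := (Imp A B) (at level 90, right associativity) : fm_scope.

Fixpoint internal (G : ctx) (A : fm G) : Prop :=
  match A with
  | Bot => True
  | Eq0 _ _ => True
  | St _ => False
  | And A B => internal A /\ internal B
  | Or A B => internal A /\ internal B
  | Imp A B => internal A /\ internal B
  | All _ A => internal A
  | Ex _ A => internal A
  end.

Fixpoint fren (G : ctx) (A : fm G) : forall D, renaming G D -> fm D :=
  match A in fm G return forall D, renaming G D -> fm D with
  | Bot => fun D f => Bot
  | Eq0 a b => fun D f => Eq0 (tren f a) (tren f b)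
  | St a => fun D f => St (tren f a)
  | And A B => fun D f => And (fren A f) (fren B f)
  | Or A B => fun D f => Or (fren A f) (fren B f)
  | Imp A B => fun D f => Imp (fren A f) (fren B f)
  | All s A => fun D f => All s (fren A (lift f))
  | Ex s A => fun D f => Ex s (fren A (lift f))
  end.

Definition fwk {G : ctx} {r : fty} (A : fm G) : fm (r :: G) := fren A shift.

(** Weakening below one, resp. two, bound variables. *)
Definition fwk1 {G : ctx} {r a : fty} (A : fm (a :: G)) : fm (a :: r :: G) :=
  fren A (lift shift).
Definition fwk2 {G : ctx} {r a b : fty} (A : fm (b :: a :: G)) :
    fm (b :: a :: r :: G) :=
  fren A (lift (lift shift)).

Fixpoint fsubst (G : ctx) (A : fm G) : forall D, substitution G D -> fm D :=
  match A in fm G return forall D, substitution G D -> fm D with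
  | Bot => fun D f => Bot
  | Eq0 a b => fun D f => Eq0 (tsubst f a) (tsubst f b)
  | St a => fun D f => St (tsubst f a)
  | And A B => fun D f => And (fsubst A f) (fsubst B f)
  | Or A B => fun D f => Or (fsubst A f) (fsubst B f)
  | Imp A B => fun D f => Imp (fsubst A f) (fsubst B f)
  | All s A => fun D f => All s (fsubst A (up f))
  | Ex s A => fun D f => Ex s (fsubst A (up f))
  end.

Definition finst {G : ctx} {r : fty} (A : fm (r :: G)) (t : tm G r) : fm G :=
  fsubst A (single t).

(** * Abbreviations *)

Fixpoint feq (G : ctx) (s : fty) : tm G s -> tm G s -> fm G :=
  match s return tm G s -> tm G s -> fm G with
  | ty0 => fun x y => Eq0 x y
  | (r ~> t)%fty => fun x y => All r (feq (twk x @ v0) (twk y @ v0))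
  end.

(** [Sigma (Pi Pi) Succ] maps [p, n] to [Succ p]. *)
Definition plus {G : ctx} (x y : tm G ty0) : tm G ty0 :=
  (Rec @ x @ (Sigma @ (Pi @ Pi) @ Succ) @ y)%tm.

Definition le0 {G : ctx} (x y : tm G ty0) : fm G :=
  Ex ty0 (plus (twk x) v0 =0 twk y)%fm.

Fixpoint fle (G : ctx) (s : fty) : tm G s -> tm G s -> fm G :=
  match s return tm G s -> tm G s -> fm G with
  | ty0 => fun x y => le0 x y
  | (r ~> t)%fty => fun x y => All r (fle (twk x @ v0) (twk y @ v0))
  end.

(** Strong (Howard-Bezem) majorizability; under the two quantifiers, [v1] and
    [v0] are the arguments of the majorized and of the majorizing object. *)
Fixpoint maj (G : ctx) (s : fty) : tm G s -> tm G s -> fm G :=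
  match s return tm G s -> tm G s -> fm G with
  | ty0 => fun x y => le0 x y
  | (r ~> t)%fty => fun x y =>
      All r (All r
        (maj (v1 : tm (r :: r :: G) r) v0 ==>
         maj (twk (twk x) @ v1) (twk (twk y) @ v0) //\
         maj (twk (twk y) @ v1) (twk (twk y) @ v0)))%fm
  end.

Definition monotone {G : ctx} {s : fty} (x : tm G s) : fm G := maj x x.

Section Quantifiers.
Local Open Scope fm_scope.
Context {G : ctx} (s : fty).
Implicit Type A : fm (s :: G).

Definition AllSt A : fm G := All s (St (v0 : tm (s :: G) s) ==> A).
Definition ExSt A : fm G := Ex s (St (v0 : tm (s :: G) s) //\ A).
Definition AllMSt A : fm G := AllSt (monotone (v0 : tm (s :: G) s) ==> A).
Definition ExMSt A : fm G := ExSt (monotone (v0 : tm (s :: G) s) //\ A).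
Definition AllMaj (t : tm G s) A : fm G := All s (maj v0 (twk t) ==> A).
Definition ExMaj (t : tm G s) A : fm G := Ex s (maj v0 (twk t) //\ A).
Definition ExMMaj (t : tm G s) A : fm G :=
  Ex s (monotone (v0 : tm (s :: G) s) //\ maj v0 (twk t) //\ A).
End Quantifiers.

(** * Intuitionistic natural deduction over a set of axioms *)

Inductive derives (Ax : forall G : ctx, fm G -> Prop) :
    forall G : ctx, list (fm G) -> fm G -> Prop :=
| d_axiom : forall G (H : list (fm G)) A, Ax G A -> derives Ax H A
| d_hyp : forall G (H : list (fm G)) A, In A H -> derives Ax H A
| d_botE : forall G (H : list (fm G)) A, derives Ax H Bot -> derives Ax H A
| d_andI : forall G (H : list (fm G)) A B,
    derives Ax H A -> derives Ax H B -> derives Ax H (And A B)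
| d_andE1 : forall G (H : list (fm G)) A B,
    derives Ax H (And A B) -> derives Ax H A
| d_andE2 : forall G (H : list (fm G)) A B,
    derives Ax H (And A B) -> derives Ax H B
| d_orI1 : forall G (H : list (fm G)) A B,
    derives Ax H A -> derives Ax H (Or A B)
| d_orI2 : forall G (H : list (fm G)) A B,
    derives Ax H B -> derives Ax H (Or A B)
| d_orE : forall G (H : list (fm G)) A B C,
    derives Ax H (Or A B) -> derives Ax (A :: H) C -> derives Ax (B :: H) C ->
    derives Ax H C
| d_impI : forall G (H : list (fm G)) A B,
    derives Ax (A :: H) B -> derives Ax H (Imp A B)
| d_impE : forall G (H : list (fm G)) A B,
    derives Ax H (Imp A B) -> derives Ax H A -> derives Ax H B
| d_allI : forall G (H : list (fm G)) s (A : fm (s :: G)),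
    derives Ax (map fwk H) A -> derives Ax H (All s A)
| d_allE : forall G (H : list (fm G)) s (A : fm (s :: G)) (t : tm G s),
    derives Ax H (All s A) -> derives Ax H (finst A t)
| d_exI : forall G (H : list (fm G)) s (A : fm (s :: G)) (t : tm G s),
    derives Ax H (finst A t) -> derives Ax H (Ex s A)
| d_exE : forall G (H : list (fm G)) s (A : fm (s :: G)) C,
    derives Ax H (Ex s A) -> derives Ax (A :: map fwk H) (fwk C) ->
    derives Ax H C.

(** * Axioms

    All schemata allow arbitrary parameters, namely the variables of [G]. *)

(** The induction schema of E-HA^omega is for internal formulas only: for all
    formulas of the extended language it would make every number standard. *)
Inductive EHA_axiom (G : ctx) : fm G -> Prop :=
| ax_refl : forall x : tm G ty0, EHA_axiom (x =0 x)
| ax_sym : forall x y : tm G ty0, EHA_axiom (x =0 y ==> y =0 x)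
| ax_trans : forall x y z : tm G ty0,
    EHA_axiom (x =0 y ==> y =0 z ==> x =0 z)
| ax_succ_inj : forall x y : tm G ty0,
    EHA_axiom (Succ @ x =0 Succ @ y ==> x =0 y)
| ax_succ_neq0 : forall x : tm G ty0, EHA_axiom (Succ @ x =0 Zero ==> Bot)
| ax_ind : forall phi : fm (ty0 :: G), internal phi ->
    EHA_axiom (finst phi Zero //\ All ty0 (phi ==> fsubst phi succ_sub) ==>
               All ty0 phi)
| ax_Pi : forall (r s : fty) (x : tm G r) (y : tm G s),
    EHA_axiom (feq (Pi @ x @ y) x)
| ax_Sigma : forall (r s t : fty) (x : tm G (r ~> s ~> t)) (y : tm G (r ~> s))
      (z : tm G r),
    EHA_axiom (feq (Sigma @ x @ y @ z) (x @ z @ (y @ z)))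
| ax_Rec0 : forall (r : fty) (x : tm G r) (y : tm G (r ~> ty0 ~> r)),
    EHA_axiom (feq (Rec @ x @ y @ Zero) x)
| ax_RecS : forall (r : fty) (x : tm G r) (y : tm G (r ~> ty0 ~> r))
      (n : tm G ty0),
    EHA_axiom (feq (Rec @ x @ y @ (Succ @ n)) (y @ (Rec @ x @ y @ n) @ n))
| ax_ext : forall (r t : fty) (f : tm G (r ~> t)) (x y : tm G r),
    EHA_axiom (feq x y ==> feq (f @ x) (f @ y)).

Inductive DG_axiom (G : ctx) : fm G -> Prop :=
| ax_EHA : forall A : fm G, EHA_axiom A -> DG_axiom A
| ax_st_eq : forall (s : fty) (x y : tm G s),
    DG_axiom (feq x y ==> St x ==> St y)
| ax_st_maj : forall (s : fty) (x y : tm G s),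
    DG_axiom (St y ==> maj x y ==> St x)
| ax_st_closed : forall (s : fty) (t : tm [] s),
    DG_axiom (St (tclosed t : tm G s))
| ax_st_app : forall (r s : fty) (z : tm G (r ~> s)) (x : tm G r),
    DG_axiom (St z ==> St x ==> St (z @ x)%tm)
| ax_ext_ind : forall Phi : fm (ty0 :: G),
    DG_axiom (finst Phi Zero //\ AllSt (Phi ==> fsubst Phi succ_sub) ==>
              AllSt Phi)
| ax_mAC : forall (r t : fty) (Phi : fm (t :: r :: G)),
    DG_axiom (AllMSt (ExMSt Phi) ==>
              ExMSt (s := r ~> t) (AllMSt (ExMaj (v1 @ v0) (fwk2 Phi))))
| ax_R : forall (r t : fty) (Phi : fm (t :: r :: G)),
    DG_axiom (All r (ExSt Phi) ==>
              ExMSt (s := t) (All r (ExMaj v1 (fwk2 Phi))))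
| ax_I : forall (r t : fty) (phi : fm (t :: r :: G)), internal phi ->
    DG_axiom (AllMSt (s := t) (Ex r (AllMaj v1 (fwk2 phi))) ==>
              Ex r (AllSt phi))
| ax_IP : forall (r t : fty) (phi : fm (r :: G)) (Psi : fm (t :: G)),
    internal phi ->
    DG_axiom ((AllMSt phi ==> ExMSt Psi) ==>
              ExMSt (s := t) (AllMSt (fwk1 phi) ==> ExMMaj v0 (fwk1 Psi)))
| ax_M : forall (r : fty) (phi : fm (r :: G)) (psi : fm G),
    internal phi -> internal psi ->
    DG_axiom ((AllMSt phi ==> psi) ==>
              ExMSt (s := r) (AllMaj v0 (fwk1 phi) ==> fwk psi))
| ax_MAJ : forall s : fty,
    DG_axiom (AllSt (s := s) (ExSt (s := s) (maj v1 v0))).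

Definition DG_proves (A : fm []) : Prop := derives DG_axiom [] A.

(** * Continuity *)

Section Continuity.
Local Open Scope fm_scope.
Context {G : ctx}.

Definition one1 : tm G ty1 := (Pi @ (Succ @ Zero))%tm.

Definition approx1 (f g : tm G ty1) : fm G :=
  AllSt (s := ty0) (twk f @ v0 =0 twk g @ v0).
End Continuity.

Definition standard_extensional {G : ctx} (Y : tm G ty2) : fm G :=
  AllSt (s := ty1) (AllSt (s := ty1)
    (approx1 v1 v0 ==>
     twk (twk Y) @ v1 =0 twk (twk Y) @ v0))%fm.

Definition nonstandard_continuous {G : ctx} (Y : tm G ty2) : fm G :=
  All ty1 (fle v0 one1 ==>
    All ty1 (fle v0 one1 ==>
      approx1 v1 v0 ==> twk (twk Y) @ v1 =0 twk (twk Y) @ v0))%fm.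

(* Main.v *)
(** A binary sequence is majorized by the closed term [one1]; since everything
    majorized by a standard object is standard, all binary sequences are
    standard, and standard extensionality applies to them directly. *)
From Stdlib Require Import List.
Require Import Defs.
Import ListNotations.

Lemma derives_eq0_sym G (H : list (fm G)) (x y : tm G ty0) :
  derives DG_axiom H (x =0 y)%fm -> derives DG_axiom H (y =0 x)%fm.
Proof. exact (d_impE (d_axiom _ (ax_EHA (ax_sym x y)))). Qed.

Lemma derives_eq0_trans G (H : list (fm G)) (x y z : tm G ty0) :
  derives DG_axiom H (x =0 y)%fm -> derives DG_axiom H (y =0 z)%fm ->
  derives DG_axiom H (x =0 z)%fm.
Proof.
intros Hxy Hyz.
exact (d_impE (d_impE (d_axiom _ (ax_EHA (ax_trans x y z))) Hxy) Hyz).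
Qed.

Lemma derives_one1_const G (H : list (fm G)) (u v : tm G ty0) :
  derives DG_axiom H (one1 @ u =0 one1 @ v)%fm.
Proof.
apply derives_eq0_trans with (Succ @ Zero)%tm.
- exact (d_axiom H (ax_EHA (ax_Pi (Succ @ Zero) u))).
- exact (derives_eq0_sym _ _ _ _
    (d_axiom H (ax_EHA (ax_Pi (Succ @ Zero) v)))).
Qed.

(** Majorization compares values at two arguments $u\le v$, whereas [fle] compares them at one.
    Since [one1] is constant, its value at $u$ may be replaced by that at $v$; this also gives its
    own monotonicity. *)
Lemma derives_le_one1_maj G (H : list (fm G)) :
  derives DG_axiom H (All ty1 (fle v0 one1 ==> maj v0 one1)%fm).
Proof.
apply d_allI, d_impI, d_allI, d_allI, d_impI, d_andI.
- eapply d_exE.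
  (* The pointwise bound is used at the smaller argument [v1]; the difference it provides serves
     again as witness at [v0]. *)
  + refine (d_allE (s := ty0) (A := le0 (Var (VS (VS (VS VZ))) @ v0) (one1 @ v0)) v1 _).
    apply d_hyp; right; left; reflexivity.
  + refine (d_exI (t := v0) _).
    eapply derives_eq0_trans.
    * apply d_hyp; left; reflexivity.
    * exact (derives_one1_const _ _ _ _).
(* Equal values differ by [Zero], and $x+0=x$ is the base equation of [Rec]. *)
- refine (d_exI (t := Zero) _).
  eapply derives_eq0_trans.
  + exact (d_axiom _ (ax_EHA (ax_Rec0 (r := ty0) _ _))).
  + exact (derives_one1_const _ _ _ _).
Qed.

Lemma derives_le_one1_st G (H : list (fm G)) :
  derives DG_axiom H (All ty1 (fle v0 one1 ==> St (v0 : tm (ty1 :: G) ty1))%fm).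
Proof.
apply d_allI, d_impI.
refine (d_impE (d_impE (d_axiom _ (ax_st_maj v0 one1)) _) _).
(* In every context [one1] is, by computation, [tclosed] of its copy in the empty context. *)
- exact (d_axiom _ (ax_st_closed _ one1)).
- refine (d_impE (d_allE v0 (derives_le_one1_maj _ _)) _).
  apply d_hyp; left; reflexivity.
Qed.

Theorem theorem3p14 :
  DG_proves
    (All ty2 (standard_extensional v0 ==> nonstandard_continuous v0)%fm).
Proof.
apply d_allI, d_impI, d_allI, d_impI, d_allI, d_impI, d_impI.
(* Here [v1] is $f$, [v0] is $g$ and [Var (VS (VS VZ))] is $Y$. Standard extensionality of $Y$ is
   instantiated at $f$, then at $g$; what remains is that hypothesis itself, the standardness of $f$
   and of $g$, and $f\approx_1 g$. *)
refine (d_impE (d_impE (d_allE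
  (A := (St v0 ==> approx1 (Var (VS (VS VZ))) v0 ==>
           Var (VS (VS (VS VZ))) @ Var (VS (VS VZ)) =0
           Var (VS (VS (VS VZ))) @ v0)%fm) v0
  (d_impE (d_allE
     (A := (St v0 ==> AllSt (s := ty1) (approx1 v1 v0 ==>
              Var (VS (VS (VS (VS VZ)))) @ v1 =0
              Var (VS (VS (VS (VS VZ)))) @ v0))%fm) v1 _) _)) _) _).
- apply d_hyp; simpl; tauto.
- refine (d_impE (d_allE v1 (derives_le_one1_st _ _)) _).
  apply d_hyp; simpl; tauto.
- refine (d_impE (d_allE v0 (derives_le_one1_st _ _)) _).
  apply d_hyp; simpl; tauto.
- apply d_hyp; simpl; tauto.
Qed.
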